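(* Let $0<p<1$, let $U=(u_{ij})\in U(2)$, and let $k\in\mathbb{R}$. For an eigenvalue $\lambda$ of $\mathcal{L}_{k,k}$ let $\dim(\lambda)$ denote the dimension of the associated eigenspace. Then: (a) $\sum_{|\lambda|=1}\dim(\lambda)\le 2$, the sum being over the distinct eigenvalues $\lambda$ of $\mathcal{L}_{k,k}$ of modulus $1$. (b) $1$ is an eigenvalue of $\mathcal{L}_{k,k}$ and $\dim(1)\ge 1$. (c) If $\lambda$ is an eigenvalue of $\mathcal{L}_{k,k}$ with $|\lambda|=1$, then $\lambda=1$ or $\lambda=-1$. (d) $\dim(1)=2$ if and only if $u_{12}=u_{21}=0$ and $|u_{11}|=|u_{22}|=1$. In this case the multiplicity of the eigenvalue $1$ is $2$. (e) $-1$ is an eigenvalue of $\mathcal{L}_{k,k}$ if and only if $u_{11}=u_{22}=0$ and $|u_{12}|=|u_{21}|=1$. In this case the multiplicity of the eigenvalue $-1$ is $1$.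
   Context: The coin space is $H_2=\mathbb{C}^2$ with orthonormal basis $|R\rangle,|L\rangle$ (in this order for matrices), and $P_R=|R\rangle\langle R|$, $P_L=|L\rangle\langle L|$. For real $k$, $U_k=(e^{-ik}P_R+e^{ik}P_L)U$. The measurement operators are $A_0=\sqrt{1-p}\,I$, $A_1=\sqrt p\,|R\rangle\langle R|$, $A_2=\sqrt p\,|L\rangle\langle L|$. The superoperator $\mathcal{L}_{k,k}$ acts on the $4$-dimensional complex space $L(H_2)$ of linear operators on $H_2$ by $\mathcal{L}_{k,k}B=\sum_{n=0}^2U_kA_nBA_n^*U_k^*$. ''Multiplicity'' of an eigenvalue means algebraic multiplicity. *)

(* Defs.v *)
From HB Require Import structures.
From mathcomp Require Import all_boot all_order all_algebra.
From mathcomp Require Import spectral complex.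
From mathcomp Require Import classical_sets cardinality fsbigop reals trigo.

Set Implicit Arguments.
Unset Strict Implicit.
Unset Printing Implicit Defensive.

Import Order.TTheory GRing.Theory Num.Theory.

Local Open Scope classical_set_scope.
Local Open Scope ring_scope.
Local Open Scope complex_scope.
Local Open Scope sesquilinear_scope.

Section QuantumWalk.
Variable R : realType.
Local Notation C := R[i].

(* e^{it} *)
Definition expi (t : R) : C := cos t +i* sin t.

Definition ketR : 'cV[C]_2 := delta_mx 0 0.
Definition ketL : 'cV[C]_2 := delta_mx 1 0.

Definition PR : 'M[C]_2 := ketR *m ketR^t*.
Definition PL : 'M[C]_2 := ketL *m ketL^t*.

Definition Uk (U : 'M[C]_2) (k : R) : 'M[C]_2 :=
  (expi (- k) *: PR + expi k *: PL) *m U.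

Definition measurement (p : R) (n : 'I_3) : 'M[C]_2 :=
  tnth [tuple (Num.sqrt (1 - p))%:C *: 1%:M;
              (Num.sqrt p)%:C *: PR;
              (Num.sqrt p)%:C *: PL] n.

Definition Lkk (p : R) (U : 'M[C]_2) (k : R) (B : 'M[C]_2) : 'M[C]_2 :=
  \sum_(n < 3)
    Uk U k *m measurement p n *m B *m (measurement p n)^t* *m (Uk U k)^t*.

Fact Lkk_is_linear p U k : linear (Lkk p U k).
Proof.
move=> a B D; rewrite /Lkk scaler_sumr -big_split; apply: eq_bigr => n _ /=.
by rewrite mulmxDr !mulmxDl -scalemxAr -!scalemxAl.
Qed.

HB.instance Definition _ p U k :=
  GRing.isLinear.Build C 'M[C]_2 'M[C]_2 _ (Lkk p U k) (Lkk_is_linear p U k).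

(* Operators on H_2 are flattened to row vectors by mxvec, and matrices act on
   row vectors from the right: mxvec B *m Lkk_mx p U k = mxvec (Lkk p U k B). *)
Definition Lkk_mx (p : R) (U : 'M[C]_2) (k : R) : 'M[C]_(2 * 2) :=
  lin_mx (Lkk p U k).

Lemma mem_eigenspace_Lkk p U k a (B : 'M[C]_2) :
  (mxvec B <= eigenspace (Lkk_mx p U k) a)%MS = (Lkk p U k B == a *: B).
Proof.
apply/eigenspaceP/eqP; rewrite mul_vec_lin -linearZ /=; last by move=> ->.
exact: (can_inj mxvecK).
Qed.

Definition eigdim (p : R) (U : 'M[C]_2) (k : R) (a : C) : nat :=
  \rank (eigenspace (Lkk_mx p U k) a).

Definition eigmult (p : R) (U : 'M[C]_2) (k : R) (a : C) : nat :=
  mup a (char_poly (Lkk_mx p U k)).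

Definition unimodular_eigenvalues (p : R) (U : 'M[C]_2) (k : R) : set C :=
  [set a | eigenvalue (Lkk_mx p U k) a /\ `|a| = 1].

(* Finitely supported sums over a set default to 0 when the support is
   infinite; this shows that the default does not arise here. *)
Lemma finite_unimodular_eigenvalues p U k :
  finite_set (unimodular_eigenvalues p U k).
Proof.
have [rs Ers] := closed_field_poly_normal (char_poly (Lkk_mx p U k)).
apply: (@sub_finite_set _ _ [set` rs]); last exact: finite_seq.
move=> a [+ _]; rewrite eigenvalue_root_char Ers rootZ ?root_prod_XsubC //.
by rewrite lead_coef_eq0 monic_neq0 ?char_poly_monic.
Qed.

End QuantumWalk.

(* Main.v *)
(* Writing V = U_k and q = 1 - p, the operator is B |-> V (dephase q B) V^*,
   where dephasing multiplies the off-diagonal entries by q < 1 and conjugation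
   by V preserves the Frobenius norm. Hence an eigenvector B for an eigenvalue
   of modulus 1 has no off-diagonal part, say B = diag(x, y), and the vanishing
   of the off-diagonal part of V B V^* reads V00 (V10)^* (x - y) = 0. So either
   B is scalar, or V is diagonal and fixes every diagonal operator, or V is
   antidiagonal and swaps x and y, which gives the eigenvalues 1 and -1. The
   algebraic multiplicities come from diagonalising the operator explicitly in
   the last two cases. *)

From HB Require Import structures.
Require Import Defs.
From mathcomp Require Import all_boot all_order all_algebra.
From mathcomp Require Import spectral complex ring.
From mathcomp Require Import classical_sets fsbigop reals trigo.

Set Implicit Arguments.
Unset Strict Implicit.
Unset Printing Implicit Defensive.

Import Order.TTheory GRing.Theory Num.Theory.

Local Open Scope ring_scope.
Local Open Scope sesquilinear_scope.

(** * Spectral tools for linear operators on spaces of matrices *)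

Section LinMx.
Variables (F : fieldType) (m n : nat).
Implicit Types (f : {linear 'M[F]_(m, n) -> 'M[F]_(m, n)}) (a : F).

Lemma eigenspace_lin_mxP f a (B : 'M[F]_(m, n)) :
  reflect (f B = a *: B) (mxvec B <= eigenspace (lin_mx f) a)%MS.
Proof.
apply: (iffP eigenspaceP); rewrite mul_vec_lin -linearZ /=; last by move->.
exact: (can_inj mxvecK).
Qed.

Lemma eigenvalue_lin_mxP f a :
  reflect (exists2 B, f B = a *: B & B != 0) (eigenvalue (lin_mx f) a).
Proof.
apply: (iffP eigenvalueP) => [[v fv v0]|[B fB B0]]; last first.
  exists (mxvec B); first by rewrite mul_vec_lin fB linearZ.
  by apply: contra_neq B0 => h; rewrite -[B]mxvecK h linear0.
exists (vec_mx v); last by apply: contra_neq v0 => h; rewrite -[v]vec_mxK h linear0.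
by rewrite -mx_rV_lin fv linearZ.
Qed.

End LinMx.

(** The intertwining relation lifts to the characteristic matrices, because ['X] is scalar; the
    determinant of [P], a nonzero constant polynomial, then cancels. *)
Lemma char_poly_similar (F : fieldType) n (P M D : 'M[F]_n) :
  P \in unitmx -> P *m M = D *m P -> char_poly M = char_poly D.
Proof.
move=> uP PM; rewrite /char_poly.
have e : map_mx polyC P *m char_poly_mx M = char_poly_mx D *m map_mx polyC P.
  by rewrite /char_poly_mx mulmxBr mulmxBl -!map_mxM PM scalar_mxC.
apply: (@mulIf _ (\det (map_mx polyC P))).
  by rewrite det_map_mx polyC_eq0 -unitfE.
by rewrite mulrC -!det_mulmx e.
Qed.

(** An injective [T] carries the matrix units to an eigenbasis, so [lin_mx T] is a change of basis
    that diagonalises [lin_mx f]. This turns explicit eigenvectors into algebraic multiplicities. *)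
Lemma char_poly_lin_mx_eigenbasis (F : fieldType) m n
    (f T : {linear 'M[F]_(m, n) -> 'M[F]_(m, n)}) (d : 'I_m -> 'I_n -> F) :
    injective T ->
    (forall i j, f (T (delta_mx i j)) = d i j *: T (delta_mx i j)) ->
  char_poly (lin_mx f) = \prod_i \prod_j ('X - (d i j)%:P).
Proof.
move=> injT fT; pose D := diag_mx (mxvec (\matrix_(i, j) d i j)).
rewrite (@char_poly_similar _ _ (lin_mx T) _ D).
- rewrite char_poly_trig ?diag_mx_is_trig //.
  rewrite pair_big /= (reindex (uncurry (@mxvec_index m n))) /=.
    by apply: eq_bigr => -[i j] _ /=; rewrite mxE eqxx mulr1n mxvecE mxE.
  exact: curry_mxvec_bij.
- rewrite -row_free_unit; apply: inj_row_free => v.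
  rewrite mul_rV_lin => /(congr1 vec_mx); rewrite mxvecK linear0 -(linear0 T).
  by move=> /injT/(congr1 mxvec); rewrite vec_mxK linear0.
apply/row_matrixP => s; case/mxvec_indexP: s => i j.
have rowT : row (mxvec_index i j) (lin_mx T) = mxvec (T (delta_mx i j)).
  by rewrite rowE -mxvec_delta mul_vec_lin.
rewrite row_mul rowT mul_vec_lin fT linearZ /= -rowT; apply/rowP => k.
by rewrite mul_diag_mx !mxE mxvecE mxE.
Qed.

(** * Unitary matrices of size 2 and the Frobenius norm *)

Lemma sum_ord2 (V : nmodType) (F : 'I_2 -> V) : \sum_i F i = F 0 + F 1.
Proof.
rewrite !big_ord_recl big_ord0 addr0; congr (_ + F _); exact/val_inj.
Qed.

Lemma ord2P (P : 'I_2 -> Prop) : P 0 -> P 1 -> forall i, P i.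
Proof.
move=> P0 P1 [[|[|//]] lt_i2]; [move: P0 | move: P1]; congr P; exact/val_inj.
Qed.

Section Unitary2.
Variables (C : numClosedFieldType) (V : 'M[C]_2).
Hypothesis uV : V \is unitarymx.

Lemma unitary2_dot_row i j : V i 0 * (V j 0)^* + V i 1 * (V j 1)^* = (i == j)%:R.
Proof.
have := congr1 (fun M : 'M_2 => M i j) (unitarymxP uV).
by rewrite !mxE sum_ord2 !mxE.
Qed.

Lemma unitary2_dot_col i j : V 0 i * (V 0 j)^* + V 1 i * (V 1 j)^* = (i == j)%:R.
Proof.
have := uV; rewrite -trmx_unitary => /unitarymxP.
by move=> /(congr1 (fun M : 'M_2 => M i j)); rewrite !mxE sum_ord2 !mxE.
Qed.

(** Rows and columns have norm 1: if [V 1 0] vanishes, column 0 gives [V 0 0] modulus 1, which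
    leaves nothing for [V 0 1] in row 0. The criterion for diagonal [V] thus reduces to one
    equation. *)
Lemma unitary2_diagP :
  V 1 0 = 0 <-> [/\ V 0 1 = 0, V 1 0 = 0, `|V 0 0| = 1 & `|V 1 1| = 1].
Proof.
split=> [V10|[]//]; split=> //; first last.
- have /eqP := unitary2_dot_row 1 1.
  by rewrite V10 mul0r add0r -normCK sqrp_eq1 // => /eqP.
- have /eqP := unitary2_dot_col 0 0.
  by rewrite V10 mul0r addr0 -normCK sqrp_eq1 // => /eqP.
have /eqP := unitary2_dot_row 0 0; have /eqP := unitary2_dot_col 0 0.
rewrite V10 mul0r addr0 => /eqP -> /eqP/(canRL (addKr _)).
by rewrite addNr -normCK => /eqP; rewrite sqrf_eq0 normr_eq0 => /eqP.
Qed.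

Lemma unitary2_antidiagP :
  V 0 0 = 0 <-> [/\ V 0 0 = 0, V 1 1 = 0, `|V 0 1| = 1 & `|V 1 0| = 1].
Proof.
split=> [V00|[]//]; split=> //; first last.
- have /eqP := unitary2_dot_col 0 0.
  by rewrite V00 mul0r add0r -normCK sqrp_eq1 // => /eqP.
- have /eqP := unitary2_dot_row 0 0.
  by rewrite V00 mul0r add0r -normCK sqrp_eq1 // => /eqP.
have /eqP := unitary2_dot_row 1 1; have /eqP := unitary2_dot_col 0 0.
rewrite V00 mul0r add0r => /eqP -> /eqP/(canRL (addKr _)).
by rewrite addNr -normCK => /eqP; rewrite sqrf_eq0 normr_eq0 => /eqP.
Qed.

(** The inner unitary factors cancel directly, the outer ones by cyclicity of the trace. *)
Lemma tr_conj_unitary (B : 'M[C]_2) :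
  \tr ((V *m B *m V^t*) *m (V *m B *m V^t*)^t*) = \tr (B *m B^t*).
Proof.
have uVt := unitarymxP (etrans (trmxC_unitary V) uV); rewrite trmxCK in uVt.
rewrite trmx_mul map_mxM trmxCK trmx_mul map_mxM -!mulmxA (mulmxA _ V) uVt.
by rewrite mul1mx mxtrace_mulC -!mulmxA uVt mulmx1.
Qed.

End Unitary2.

Lemma tr_mulmx_trmxC (C : numClosedFieldType) m n (B : 'M[C]_(m, n)) :
  \tr (B *m B^t*) = \sum_i \sum_j `|B i j| ^+ 2.
Proof.
rewrite /mxtrace; apply: eq_bigr => i _; rewrite mxE; apply: eq_bigr => j _.
by rewrite !mxE normCK.
Qed.

(** * Root multiplicities and the eigenbasis of the antidiagonal case *)

Lemma mup_prod_XsubC_matrix (F : fieldType) m n (a : F) (d : 'I_m -> 'I_n -> F) :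
  mup a (\prod_i \prod_j ('X - (d i j)%:P)) = (\sum_i \sum_j (d i j == a))%N.
Proof.
rewrite !pair_bigA /= -(big_map (fun p => d p.1 p.2) predT (fun y => 'X - y%:P)).
rewrite mu_prod_XsubC count_map -sum1_count big_mkcond /=.
by apply: eq_bigr => p _; case: eqP.
Qed.

(* Maps E00, E01, E10, E11 to I, E01 + g E10, E01 - g E10, diag(1, -1); for
   g = V 1 0 * (V 0 1)^* these are the eigenvectors of the walk when V is
   antidiagonal, with eigenvalues 1, q, -q, -1. *)
Definition antidiag_eigenbasis (R : pzRingType) (g : R) (B : 'M[R]_2) : 'M[R]_2 :=
  \matrix_(i, j)
    if i == j then B 0 0 + (-1) ^+ i * B 1 1
    else g ^+ i * (B 0 1 + (-1) ^+ i * B 1 0).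

Fact antidiag_eigenbasis_is_linear (R : comPzRingType) (g : R) :
  linear (antidiag_eigenbasis g).
Proof.
by move=> a B D; apply/matrixP => i j; rewrite !mxE; case: (i == j); ring.
Qed.

HB.instance Definition _ (R : comPzRingType) (g : R) :=
  GRing.isLinear.Build R 'M[R]_2 'M[R]_2 _ (antidiag_eigenbasis g)
    (antidiag_eigenbasis_is_linear g).

(** The image records sums and differences of pairs of entries, up to the nonzero factor [g]; twice
    each entry is recovered from them, and 2 is invertible. *)
Lemma antidiag_eigenbasis_inj (F : numFieldType) (g : F) :
  g != 0 -> injective (antidiag_eigenbasis g).
Proof.
move=> g0 B D /matrixP e.
have := e 0 0; have := e 0 1; have := e 1 0; have := e 1 1.
rewrite !mxE /= !expr0 !expr1 !mul1r !mulN1r.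
move=> e11 /(mulfI g0) e10 e01 e00.
have two : (2 : F) != 0 by rewrite pnatr_eq0.
apply/matrixP; do 2!apply: ord2P; apply: (mulfI two).
- transitivity ((B 0 0 + B 1 1) + (B 0 0 - B 1 1)); first by ring.
  by rewrite e00 e11; ring.
- transitivity ((B 0 1 + B 1 0) + (B 0 1 - B 1 0)); first by ring.
  by rewrite e01 e10; ring.
- transitivity ((B 0 1 + B 1 0) - (B 0 1 - B 1 0)); first by ring.
  by rewrite e01 e10; ring.
- transitivity ((B 0 0 + B 1 1) - (B 0 0 - B 1 1)); first by ring.
  by rewrite e00 e11; ring.
Qed.

(** * Dephasing as the effect of the measurement *)

Definition dephase (C : pzRingType) (q : C) (B : 'M[C]_2) : 'M[C]_2 :=
  \matrix_(i, j) (if i == j then B i j else q * B i j).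

(** The two projections only see the diagonal, where the weights add up to 1; off the diagonal only
    the multiple of the identity contributes. *)
Lemma kraus_dephase (C : numClosedFieldType) (a b : C) (B : 'M[C]_2) :
    a * a^* + b * b^* = 1 ->
  \sum_(A <- [:: a *: 1%:M; b *: delta_mx 0 0; b *: delta_mx 1 1])
    A *m B *m A^t* = dephase (a * a^*) B.
Proof.
move=> ab1; rewrite !big_cons big_nil addr0.
have conjM x (M : 'M[C]_2) :
    (x *: M) *m B *m (x *: M)^t* = (x * x^*) *: (M *m B *m M^t*).
  by rewrite linearZ map_mxZ -!scalemxAl -scalemxAr scalerA.
rewrite !conjM; apply/matrixP; do 2!apply: ord2P;
  rewrite !mxE /= !sum_ord2 !mxE /= !sum_ord2 !mxE /= ?conjC0 ?conjC1.
- by rewrite -[RHS]mul1r -[X in _ = X * _]ab1; ring.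
- by ring.
- by ring.
- by rewrite -[RHS]mul1r -[X in _ = X * _]ab1; ring.
Qed.

(** * Peripheral spectrum of dephasing followed by unitary conjugation *)

Section DephasedConjugation.
Variables (C : numClosedFieldType) (V : 'M[C]_2) (q : C).
Variable f : {linear 'M[C]_2 -> 'M[C]_2}.
Hypotheses (uV : V \is unitarymx) (q_ge0 : 0 <= q) (q_lt1 : q < 1).
Hypothesis fE : forall B, f B = V *m dephase q B *m V^t*.

Lemma step_ijE B i j :
  f B i j = V i 0 * B 0 0 * (V j 0)^* + V i 1 * B 1 1 * (V j 1)^*
            + q * (V i 0 * B 0 1 * (V j 1)^* + V i 1 * B 1 0 * (V j 0)^*).
Proof. by rewrite fE !mxE sum_ord2 !mxE !sum_ord2 !mxE /=; ring. Qed.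

Lemma step1 : f 1%:M = 1%:M.
Proof.
apply/matrixP => i j; rewrite step_ijE !mxE /=.
by rewrite -(unitary2_dot_row uV); ring.
Qed.

(* V is an isometry for the Frobenius norm, while dephasing strictly shrinks
   any off-diagonal part. *)
Lemma unimodular_eigenmx_diag a B :
  f B = a *: B -> `|a| = 1 -> exists d, B = diag_mx d.
Proof.
move=> fB a1; have := tr_conj_unitary uV (dephase q B).
rewrite -fE fB !tr_mulmx_trmxC !sum_ord2 !mxE /= !normrM a1 !mul1r.
rewrite (ger0_norm q_ge0) !exprMn => e.
have /eqP : (1 - q ^+ 2) * (`|B 0 1| ^+ 2 + `|B 1 0| ^+ 2) = 0.
  by move/eqP: e; rewrite -subr_eq0 => /eqP <-; ring.
have q2 : 1 - q ^+ 2 != 0 by rewrite subr_eq0 eq_sym lt_eqF // exprn_ilt1.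
rewrite mulf_eq0 (negPf q2) paddr_eq0 ?exprn_ge0 // !sqrf_eq0 !normr_eq0.
case/andP=> /eqP B01 /eqP B10; exists (\row_i B i i).
apply/matrixP; apply: ord2P; apply: ord2P; by rewrite !mxE /= ?mulr1n.
Qed.

Lemma step_diag_ijE d i j :
  f (diag_mx d) i j = V i 0 * d 0 0 * (V j 0)^* + V i 1 * d 0 1 * (V j 1)^*.
Proof. by rewrite step_ijE !mxE /=; ring. Qed.

Lemma eigen_diag_cases a d : f (diag_mx d) = a *: diag_mx d ->
  [\/ d 0 0 = d 0 1, V 1 0 = 0 | V 0 0 = 0].
Proof.
move=> /matrixP/(_ 0 1); rewrite step_diag_ijE !mxE /= mulr0n mulr0 => fd.
have /eqP : V 0 0 * (V 1 0)^* * (d 0 0 - d 0 1) = 0.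
  (* Subtracting [d 0 1] times the orthogonality relation of rows 0 and 1 eliminates the second
     column of [V]. *)
  have -> : V 0 0 * (V 1 0)^* * (d 0 0 - d 0 1) =
      V 0 0 * d 0 0 * (V 1 0)^* + V 0 1 * d 0 1 * (V 1 1)^*
      - d 0 1 * (V 0 0 * (V 1 0)^* + V 0 1 * (V 1 1)^*) by ring.
  by rewrite fd (unitary2_dot_row uV 0 1) mulr0 subr0.
rewrite !mulf_eq0 conjC_eq0 subr_eq0 => /orP[/orP[]|] /eqP ->.
- by constructor 3.
- by constructor 2.
- by constructor 1.
Qed.

Lemma step_diag_fixed d : V 1 0 = 0 -> f (diag_mx d) = diag_mx d.
Proof.
move=> V10; have [V01 _ V00 V11] := (unitary2_diagP uV).1 V10.
apply/matrixP; apply: ord2P; apply: ord2P; rewrite step_diag_ijE !mxE /= ?V01 ?V10;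
  by rewrite ?conjC0 ?(mulrAC _ _ _^*) -?normCK ?V00 ?V11 ?expr1n ?mulr1n ?mulr0n; ring.
Qed.

Lemma step_diag_swap d :
  V 0 0 = 0 -> f (diag_mx d) = diag_mx (\row_i d 0 (1 - i)).
Proof.
move=> V00; have [_ V11 V01 V10] := (unitary2_antidiagP uV).1 V00.
apply/matrixP; apply: ord2P; apply: ord2P; rewrite step_diag_ijE !mxE /= ?V00 ?V11;
  by rewrite ?conjC0 ?(mulrAC _ _ _^*) -?normCK ?V01 ?V10 ?expr1n ?subr0 ?subrr
             ?mulr1n ?mulr0n; ring.
Qed.

Lemma step_diag_const (d : 'rV_2) : d 0 0 = d 0 1 -> f (diag_mx d) = diag_mx d.
Proof.
move=> d01; have -> : diag_mx d = d 0 0 *: 1%:M.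
  apply/matrixP; apply: ord2P; apply: ord2P; by rewrite !mxE /= ?mulr0 ?mulr1 //.
by rewrite linearZ /= step1.
Qed.

(** The eigenvector is diagonal, and it is fixed by [f] unless [V 0 0 = 0]. Keeping that equation
    beside [a = -1] provides one half of the criterion for the eigenvalue -1. *)
Lemma unimodular_eigenvalue a : eigenvalue (lin_mx f) a -> `|a| = 1 ->
  a = 1 \/ a = -1 /\ V 0 0 = 0.
Proof.
move=> /eigenvalue_lin_mxP[B fB B0] a1.
have [d Ed] := unimodular_eigenmx_diag fB a1; rewrite {B}Ed in fB B0.
have fixed : f (diag_mx d) = diag_mx d -> a = 1.
  rewrite fB -[RHS]scale1r => /eqP; rewrite -subr_eq0 -scalerBl scaler_eq0.
  by rewrite (negPf B0) orbF subr_eq0 => /eqP.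
have [/step_diag_const/fixed|/step_diag_fixed/fixed|V00] := eigen_diag_cases fB.
- by left.
- by left.
have /matrixP e := etrans (esym (step_diag_swap d V00)) fB.
have := e 0 0; have := e 1 1; rewrite !mxE /= !mulr1n subr0 subrr => d0 d1.
(* Swapping twice restores [d], so [a ^+ 2] acts as 1 on a nonzero operator. *)
have : (1 - a ^+ 2) *: diag_mx d = 0.
  apply/matrixP; apply: ord2P; apply: ord2P; rewrite !mxE /=
    ?mulr1n ?mulr0n ?mulr0 //.
    by rewrite mulrBl expr2 -mulrA -d1 -d0 mul1r subrr.
  by rewrite mulrBl expr2 -mulrA -d0 -d1 mul1r subrr.
move/eqP; rewrite scaler_eq0 (negPf B0) orbF subr_eq0 eq_sym sqrf_eq1.
by case/orP=> /eqP ->; [left | right].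
Qed.

Lemma eigenvalue_step1 : eigenvalue (lin_mx f) 1.
Proof.
by apply/eigenvalue_lin_mxP; exists 1%:M; rewrite ?step1 ?scale1r ?oner_eq0.
Qed.

Lemma eigenvalue_stepN1 : eigenvalue (lin_mx f) (-1) <-> V 0 0 = 0.
Proof.
split=> [/unimodular_eigenvalue|V00].
  rewrite normrN1 => /(_ erefl)[/eqP|[]//].
  by rewrite eqNr oner_eq0.
(* The witness is diag(1, -1), which the swap negates. *)
apply/eigenvalue_lin_mxP; exists (diag_mx (\row_i (-1) ^+ i)).
  rewrite step_diag_swap //; apply/matrixP; apply: ord2P; apply: ord2P;
  by rewrite !mxE /= ?subr0 ?subrr ?mulr0 // expr0 expr1 ?mulr1n; ring.
apply: contraTneq isT => /matrixP/(_ 0 0)/eqP; rewrite !mxE /= expr0 mulr1n.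
by rewrite oner_eq0.
Qed.

(* The row space of this 2 x 4 matrix is the space of diagonal operators. *)
Definition diag_rows : 'M[C]_(2, 2 * 2) := lin1_mx (mxvec \o @diag_mx C 2).

Lemma mul_diag_rows d : d *m diag_rows = mxvec (diag_mx d).
Proof. by rewrite mul_rV_lin1. Qed.

Lemma unimodular_eigenspace_sub a :
  `|a| = 1 -> (eigenspace (lin_mx f) a <= diag_rows)%MS.
Proof.
move=> a1; apply/rV_subP => v; rewrite -[v]vec_mxK => /eigenspace_lin_mxP fB.
have [d ->] := unimodular_eigenmx_diag fB a1.
by rewrite -mul_diag_rows submxMl.
Qed.

Lemma rank_diag_rows : \rank diag_rows = 2%N.
Proof.
apply/eqP; rewrite -/(row_free _); apply: inj_row_free => d.
rewrite mul_diag_rows => /(congr1 vec_mx); rewrite mxvecK linear0 => /matrixP e.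
by apply/rowP => i; move: (e i i); rewrite !mxE eqxx mulr1n.
Qed.

Lemma rank_eigenspace1_eq2 : \rank (eigenspace (lin_mx f) 1) = 2%N <-> V 1 0 = 0.
Proof.
split=> [rk2|V10]; last first.
  apply: etrans rank_diag_rows; apply/eqP; rewrite eqn_leq !mxrankS //.
    apply/rV_subP => v /submxP[d ->]; rewrite mul_diag_rows.
    by apply/eigenspace_lin_mxP; rewrite scale1r step_diag_fixed.
  by rewrite unimodular_eigenspace_sub ?normr1.
(* The eigenspace lies in the 2-dimensional space of diagonal operators, so having dimension 2 it is
   all of it. *)
have sub : (diag_rows <= eigenspace (lin_mx f) 1)%MS.
  rewrite -(geq_leqif (mxrank_leqif_sup _)) ?rk2 ?rank_diag_rows //.
  by rewrite unimodular_eigenspace_sub ?normr1.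
have fixed d : f (diag_mx d) = 1 *: diag_mx d.
  by apply/eigenspace_lin_mxP; rewrite -mul_diag_rows mulmx_sub.
(* The operator diag(1, 0) is neither scalar nor invariant under the swap, so only [V 1 0 = 0]
   survives. *)
have e := fixed (delta_mx 0 0).
have [/eqP|//|V00] := eigen_diag_cases e; first by rewrite !mxE /= oner_eq0.
move/matrixP/(_ 0 0)/eqP: e; rewrite step_diag_swap // !mxE /= !mulr1n mulr1.
by rewrite /= eq_sym oner_eq0.
Qed.

(** Both eigenspaces lie in the 2-dimensional space of diagonal operators, and they meet trivially
    because 1 and -1 differ. *)
Lemma sum_rank_unimodular_le2 :
  (\rank (eigenspace (lin_mx f) 1) + \rank (eigenspace (lin_mx f) (-1)) <= 2)%N.
Proof.
have ne : 1 != -1 :> C by rewrite eq_sym eqNr oner_eq0.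
rewrite -[X in (_ <= X)%N]rank_diag_rows -mxrank_disjoint_sum.
  by rewrite mxrankS // addsmx_sub !unimodular_eigenspace_sub ?normrN1 ?normr1.
apply/eqP; rewrite -submx0; apply/rV_subP => v.
rewrite sub_capmx => /andP[/eigenspaceP v1 /eigenspaceP]; rewrite v1.
move/eqP; rewrite -subr_eq0 -scalerBl scaler_eq0 subr_eq0 (negPf ne) /=.
by move/eqP->; rewrite sub0mx.
Qed.

Lemma mup1_step_diag : V 1 0 = 0 -> mup 1 (char_poly (lin_mx f)) = 2%N.
Proof.
move=> V10; have [V01 _ V00 V11] := (unitary2_diagP uV).1 V10.
pose d (i j : 'I_2) := if i == j then 1 else q * (V i i * (V j j)^*).
(* For diagonal [V] the matrix units are already eigenvectors, so the change of basis is the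
   identity. *)
rewrite (@char_poly_lin_mx_eigenbasis _ _ _ f idfun d) //; last first.
  have n0 : V 0 0 * (V 0 0)^* = 1 by rewrite -normCK V00 expr1n.
  have n1 : V 1 1 * (V 1 1)^* = 1 by rewrite -normCK V11 expr1n.
  do 2!apply: ord2P; apply/matrixP; do 2!apply: ord2P;
    rewrite /= step_ijE !mxE /= /d /= ?V01 ?V10 ?conjC0;
    by rewrite ?(mulrAC _ 1 _^*) ?n0 ?n1; ring.
(* The two off-diagonal eigenvalues have modulus [q < 1], so they do not add to the multiplicity of
   1. *)
have dne (x y : C) : `|x| = 1 -> `|y| = 1 -> (q * (x * y^*) == 1) = false.
  move=> x1 y1; apply: contraTF q_lt1 => /eqP/(congr1 Num.norm).
  by rewrite !normrM norm_conjC x1 y1 normr1 !mulr1 ger0_norm // => ->;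
    rewrite ltxx.
by rewrite mup_prod_XsubC_matrix !sum_ord2 /d /= !dne ?eqxx.
Qed.

Lemma mupN1_step_antidiag : V 0 0 = 0 -> mup (-1) (char_poly (lin_mx f)) = 1%N.
Proof.
move=> V00; have [_ V11 V01 V10] := (unitary2_antidiagP uV).1 V00.
have n0 : V 0 1 * (V 0 1)^* = 1 by rewrite -normCK V01 expr1n.
have n1 : V 1 0 * (V 1 0)^* = 1 by rewrite -normCK V10 expr1n.
pose g := V 1 0 * (V 0 1)^*.
have gK : V 0 1 * (V 1 0)^* * g = 1.
  transitivity (V 0 1 * (V 0 1)^* * (V 1 0 * (V 1 0)^*)); first by rewrite /g; ring.
  by rewrite n0 n1 mulr1.
have g0 : g != 0 by apply: contra_eq_neq gK => ->; rewrite mulr0 eq_sym oner_eq0.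
have f00 B : f B 0 0 = B 1 1.
  by rewrite step_ijE V00 -[RHS]mulr1 -n0; ring.
have f11 B : f B 1 1 = B 0 0.
  by rewrite step_ijE V11 -[RHS]mulr1 -n1; ring.
(* Multiplying by [g] clears the coefficient [V 0 1 * (V 1 0)^*], which is its inverse by [gK]. *)
have f01 B : g * f B 0 1 = q * B 1 0.
  by rewrite step_ijE V00 V11 conjC0 -[RHS]mulr1 -gK; ring.
have f10 B : f B 1 0 = q * g * B 0 1.
  by rewrite step_ijE V00 V11 conjC0 /g; ring.
pose d (i j : 'I_2) : C := (-1) ^+ i * (if i == j then 1 else q).
rewrite (@char_poly_lin_mx_eigenbasis _ _ _ f (antidiag_eigenbasis g) d) //;
    first last.
- do 2!apply: ord2P; apply/matrixP; do 2!apply: ord2P;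
    rewrite ?f00 ?f11 ?f10; try apply: (mulfI g0); rewrite ?f01 /d !mxE /=;
    by rewrite ?expr0 ?expr1; ring.
- exact: antidiag_eigenbasis_inj.
(* Among 1, [q], [- q], -1 only the last equals -1: [q < 1] excludes [- q], and [0 <= q] excludes
   [q]. *)
rewrite mup_prod_XsubC_matrix !sum_ord2 /d /= !expr0 !expr1 !mul1r mulr1 mulN1r.
rewrite eqxx eqr_opp (lt_eqF q_lt1) eq_sym eqNr oner_eq0.
by rewrite (gt_eqF (lt_le_trans (ltrN10 _) q_ge0)).
Qed.

End DephasedConjugation.

(** * The quantum walk as an instance *)

Section Walk.
Variable R : realType.

Lemma PR_delta : PR R = delta_mx 0 0.
Proof. by rewrite /PR /ketR trmx_delta map_delta_mx mul_delta_mx. Qed.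

Lemma PL_delta : PL R = delta_mx 1 1.
Proof. by rewrite /PL /ketL trmx_delta map_delta_mx mul_delta_mx. Qed.

Lemma norm_expi (t : R) : `|expi t| = 1.
Proof. by rewrite normc_def /= cos2Dsin2 sqrtr1. Qed.

Definition phase (k : R) : 'M[R[i]]_2 := expi (- k) *: PR R + expi k *: PL R.

Lemma phaseE k : phase k = diag_mx (\row_i if i == 0 then expi (- k) else expi k).
Proof.
apply/matrixP; do 2!apply: ord2P; rewrite /phase PR_delta PL_delta !mxE /=;
by rewrite ?mulr0n ?mulr1n; ring.
Qed.

Lemma phase_unitary k : phase k \is unitarymx.
Proof.
apply/unitarymxP; rewrite phaseE tr_diag_mx map_diag_mx mulmx_diag -diag_const_mx.
congr diag_mx; apply/rowP => i; rewrite !mxE -normCK.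
by case: ifP; rewrite norm_expi expr1n.
Qed.

(** The phase matrix multiplies each row by a unimodular number; hence vanishing conditions pass
    between [Uk U k] and [U]. *)
Lemma norm_Uk (U : 'M[R[i]]_2) k i j : `|Uk U k i j| = `|U i j|.
Proof.
rewrite /Uk -/(phase k) phaseE mul_diag_mx !mxE normrM.
by case: ifP; rewrite norm_expi mul1r.
Qed.

Lemma Uk_eq0 (U : 'M[R[i]]_2) k i j : Uk U k i j = 0 <-> U i j = 0.
Proof.
split=> /eqP; rewrite -normr_eq0 ?norm_Uk => h; apply/eqP.
  by rewrite -normr_eq0.
by rewrite -normr_eq0 norm_Uk.
Qed.

Lemma Uk_unitary (U : 'M[R[i]]_2) k : U \is unitarymx -> Uk U k \is unitarymx.
Proof. by move=> uU; apply: mul_unitarymx uU; apply: phase_unitary. Qed.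

Lemma LkkE (p k : R) (U : 'M[R[i]]_2) B : 0 <= p <= 1 ->
  Lkk p U k B = Uk U k *m dephase (1 - p)%:C%C B *m (Uk U k)^t*.
Proof.
case/andP=> p0 p1; rewrite /Lkk.
transitivity (Uk U k *m (\sum_(n < 3) measurement p n *m B *m (measurement p n)^t*)
              *m (Uk U k)^t*).
  by rewrite mulmx_sumr mulmx_suml; apply: eq_bigr => n _; rewrite !mulmxA.
congr (_ *m _ *m _).
have sq (x : R) : 0 <= x -> (Num.sqrt x)%:C%C * ((Num.sqrt x)%:C%C)^* = x%:C%C.
  move=> x0; rewrite -normCK ger0_norm ?ler0c ?sqrtr_ge0 //.
  by rewrite -rmorphXn sqr_sqrtr.
(* The indexed sum becomes a sum over the list of operators; the squared weights [1 - p] and [p] add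
   up to 1. *)
rewrite -(big_tuple _ _ _ predT (fun A : 'M_2 => A *m B *m A^t*)).
rewrite PR_delta PL_delta kraus_dephase !sq ?subr_ge0 //.
by rewrite -rmorphD subrK.
Qed.

End Walk.

Theorem theorem4p1 (R : realType) (p k : R) (U : 'M[R[i]]_2)
    (hp0 : 0 < p) (hp1 : p < 1) (hU : U \is unitarymx) :
  [/\ (\big[addn/0%N]_(a \in unimodular_eigenvalues p U k)
         eigdim p U k a <= 2)%N,
      eigenvalue (Lkk_mx p U k) 1 /\ (1 <= eigdim p U k 1%R)%N,
      forall a : R[i], eigenvalue (Lkk_mx p U k) a -> `|a| = 1 ->
        a = 1 \/ a = -1,
      (eigdim p U k 1 = 2%N <->
         [/\ U 0 1 = 0, U 1 0 = 0, `|U 0 0| = 1 & `|U 1 1| = 1]) /\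
      (eigdim p U k 1 = 2%N -> eigmult p U k 1 = 2%N)
    & (eigenvalue (Lkk_mx p U k) (-1) <->
         [/\ U 0 0 = 0, U 1 1 = 0, `|U 0 1| = 1 & `|U 1 0| = 1]) /\
      (eigenvalue (Lkk_mx p U k) (-1) -> eigmult p U k (-1) = 1%N)].
Proof.
have uV := Uk_unitary k hU.
have q0 : 0 <= (1 - p)%:C%C by rewrite ler0c subr_ge0 ltW.
have q1 : (1 - p)%:C%C < 1 by rewrite -(rmorph1 (real_complex R)) ltcR gtrBl.
have fE B : Lkk p U k B = Uk U k *m dephase (1 - p)%:C%C B *m (Uk U k)^t*.
  by rewrite LkkE // !ltW.
have peripheral a : eigenvalue (Lkk_mx p U k) a -> `|a| = 1 -> a = 1 \/ a = -1.
  by move=> /(unimodular_eigenvalue uV q0 q1 fE)/[apply] -[|[]]; [left | right].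
have le2 : (eigdim p U k 1%R + eigdim p U k (-1)%R <= 2)%N.
  exact: sum_rank_unimodular_le2 uV q0 q1 fE.
have dim2 : eigdim p U k 1 = 2%N <-> U 1 0 = 0.
  exact: iff_trans (rank_eigenspace1_eq2 uV q0 q1 fE) (Uk_eq0 U k 1 0).
have evN1 : eigenvalue (Lkk_mx p U k) (-1) <-> U 0 0 = 0.
  exact: iff_trans (eigenvalue_stepN1 uV q0 q1 fE) (Uk_eq0 U k 0 0).
split=> //.
(* The sum is extended to both 1 and -1. If one of them is not an eigenvalue, its eigenspace is zero
   and the added term vanishes. *)
- rewrite (fsbig_fwiden [:: 1; -1]) => [|a [] /peripheral/[apply]||a [/= aN1 aP]].
  + by move: le2; move: (eigdim p U k) => dim; rewrite !big_cons big_nil /= addn0.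
  + by rewrite /= !inE => -[->|->]; rewrite eqxx ?orbT.
  + by rewrite /= inE eq_sym eqNr oner_eq0.
  + apply/eqP; rewrite mxrank_eq0; apply: contra_notT aP => ev; split=> //.
    by move: aN1; rewrite !inE => /orP[] /eqP ->; rewrite ?normrN1 ?normr1.
- have ev1 := eigenvalue_step1 uV fE; split=> //.
  by rewrite /eigdim lt0n mxrank_eq0.
- split; first exact: iff_trans dim2 (unitary2_diagP hU).
  by move=> /dim2/(Uk_eq0 U k 1 0)/(mup1_step_diag uV q0 q1 fE).
- split; first exact: iff_trans evN1 (unitary2_antidiagP hU).
  by move=> /evN1/(Uk_eq0 U k 0 0)/(mupN1_step_antidiag uV q0 q1 fE).
Qed.
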